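(* Let $A,B\in\mathbb{C}^{n\times n}$ (with $B\ne0$), let $\alpha_{\rm opt}=\|B\|_2^{-1/2}$, and let $Q_k\in\mathbb{C}^{n\times d_k}$ be the matrix computed by the two-level orthogonal Arnoldi (TOAR) method applied to the scaled companion matrix $$C_{\alpha_{\rm opt}}=\begin{bmatrix}\alpha_{\rm opt}A&\alpha_{\rm opt}^2B\\ I_n&0\end{bmatrix}$$ in a computer with unit roundoff equal to $\epsilon$. Then the following statements hold. (i) If $\|A\|_2\le\|B\|_2^{1/2}$, then the subspace spanned by the columns of $Q_k$ is within a distance $O(\epsilon)$ of a second-order Krylov subspace associated with matrices $A+\Delta A$ and $B+\Delta B$ such that $$\|\Delta A\|_2=O(\epsilon)\|B\|_2^{1/2}\quad\text{and}\quad\frac{\|\Delta B\|_2}{\|B\|_2}=O(\epsilon).$$ (ii) If $\|A\|_2\approx\|B\|_2^{1/2}$, then the subspace spanned by the columns of $Q_k$ is within a distance $O(\epsilon)$ of a second-order Krylov subspace associated with matrices $A+\Delta A$ and $B+\Delta B$ such that $$\max\left\{\frac{\|\Delta A\|_2}{\|A\|_2},\frac{\|\Delta B\|_2}{\|B\|_2}\right\}=O(\epsilon).$$ (iii) If $\|A\|_2>\|B\|_2^{1/2}$, then the subspace spanned by the columns of $Q_k$ is within a distance $O(\epsilon)\|B\|_2^{-1/2}\|A\|_2$ of a second-order Krylov subspace associated with matrices $A+\Delta A$ and $B+\Delta B$ such that $$\frac{\|\Delta A\|_2}{\|A\|_2}=O(\epsilon)\quad\text{and}\quad\|\Delta B\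|_2=O(\epsilon)\|A\|_2^2.$$
   Context: A second-order Krylov subspace associated with $M,N\in\mathbb{C}^{n\times n}$ is a subspace $\mathcal{G}_k(M,N;r_{-1},r_0):=\mathrm{span}\{r_{-1},r_0,\dots,r_{k-1}\}$ for some $r_{-1},r_0\in\mathbb{C}^n$, where $r_i=Mr_{i-1}+Nr_{i-2}$ for $i=1,\dots,k-1$. The distance between subspaces of equal dimension is $\mathrm{dist}(\mathcal{S},\mathcal{T}):=\|P_{\mathcal{S}}-P_{\mathcal{T}}\|_2$ with $P_{\mathcal{S}},P_{\mathcal{T}}$ the orthogonal projectors onto $\mathcal{S},\mathcal{T}$. $\|\cdot\|_2$ is the spectral norm, $\otimes$ the Kronecker product, $^\dagger$ the Moore-Penrose pseudoinverse, and $O(\epsilon)$ denotes any quantity that is upper bounded by $\epsilon$ times a modest constant; the statements are to first order in $\epsilon$. The symbol $\approx$ is used informally, for quantities of about the same size. The TOAR method is a memory-efficient variant of the Arnoldi method applied to a companion matrix $C=\begin{bmatrix} M&N\\ I_n&0\end{bmatrix}$ (here $M=\alpha_{\rm opt}A$, $N=\alpha_{\rm opt}^2B$, $C=C_{\alpha_{\rm opt}}$) for computing an orthonormal basis, given by the columns of $Q_k$, of a second-order Krylov subspace associated with $M$ and $N$. In exact arithmetic it computes $Q_k$, $\mathbf{U}_k$ with orthonormal columns and an upper Hessenberg matrix $\underline{H}_k\in\mathbb{C}^{(k+1)\times k}$ with $C(I_2\otimes Q_k)\mathbf{U}_k=(I_2\otimes Q_{k+1})\mathbf{U}_{k+1}\underline{H}_k$.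 In floating point arithmetic with unit roundoff $\epsilon$ (with the orthogonalization steps properly carried out) the computed matrices have the form $Q_k\in\mathbb{C}^{n\times d_k}$ with $d_k\le k+1$, $Q_{k+1}=\begin{bmatrix} Q_k&q_{k+1}\end{bmatrix}\in\mathbb{C}^{n\times(d_k+1)}$, $\mathbf{U}_k=\begin{bmatrix} U_k^{[1]}\\ U_k^{[2]}\end{bmatrix}\in\mathbb{C}^{2d_k\times k}$, and $\mathbf{U}_{k+1}=\begin{bmatrix} U_{k+1}^{[1]}\\ U_{k+1}^{[2]}\end{bmatrix}\in\mathbb{C}^{2(d_k+1)\times(k+1)}$ with $U_{k+1}^{[1]}=\begin{bmatrix} U_k^{[1]}&x_k\\0&\beta_k\end{bmatrix}$, $U_{k+1}^{[2]}=\begin{bmatrix} U_k^{[2]}&y_k\\0&0\end{bmatrix}$, for some $x_k,y_k\in\mathbb{C}^{d_k}$, $\beta_k\in\mathbb{C}$. The computed $Q_k,Q_{k+1},\mathbf{U}_k,\mathbf{U}_{k+1}$ have full column rank and, up to working precision, orthonormal columns, so that $\|Q_k\|_2\|Q_k^\dagger\|_2=1+O(\epsilon)$ and $\|\mathbf{U}_k\|_2\|\mathbf{U}_k^\dagger\|_2=1+O(\epsilon)$, and the residual $R=C(I_2\otimes Q_k)\mathbf{U}_k-(I_2\otimes Q_{k+1})\mathbf{U}_{k+1}\underline{H}_k$ satisfies $\|R\|_2=O(\epsilon)\|C\|_2$. *)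

(* Defs.v *)
From mathcomp Require Import all_boot all_order all_algebra.
From mathcomp Require Import boolp classical_sets reals.
From mathcomp Require Import complex.

Set Implicit Arguments.
Unset Strict Implicit.
Unset Printing Implicit Defensive.

Import Order.TTheory GRing.Theory Num.Theory.

Local Open Scope ring_scope.
Local Open Scope complex_scope.
Local Open Scope sesquilinear_scope.

Section Norm.
Variable R : realType.

Definition vnorm2 n (v : 'cV[R[i]]_n) : R :=
  Num.sqrt (\sum_i Normc.normc (v i 0) ^+ 2).

(* The supremum is over the closed unit ball rather than the unit sphere so
   that the norm of a matrix without columns is 0. *)
Definition mnorm2 m n (X : 'M[R[i]]_(m, n)) : R :=
  sup [set vnorm2 (X *m v) | v in [set v : 'cV_n | vnorm2 v <= 1]]%classic.

Definition moore_penrose m n (X : 'M[R[i]]_(m, n)) (Y : 'M[R[i]]_(n, m)) : Prop :=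
  [/\ X *m Y *m X = X, Y *m X *m Y = Y,
      (X *m Y)^t* = X *m Y & (Y *m X)^t* = Y *m X].

End Norm.

Section Subspaces.
Variables (R : realType) (n : nat).
Local Notation C := R[i].

Definition colspace d (Q : 'M[C]_(n, d)) : {vspace 'cV[C]_n} :=
  <<[seq col j Q | j : 'I_d]>>%VS.

(* proj_ortho acts on row vectors from the right; a basis of S is stored as the
   rows of a matrix and the resulting projector is transposed, so that
   orthoproj S acts on column vectors from the left. *)
Definition orthoproj (S : {vspace 'cV[C]_n}) : 'M[C]_n :=
  (proj_ortho (\matrix_(i < \dim S) ((vbasis S)`_i)^T))^T.

Lemma orthoproj_mem (S : {vspace 'cV[C]_n}) (v : 'cV[C]_n) :
  (v \in S) = (orthoproj S *m v == v).
Proof.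
rewrite /orthoproj; set U := \matrix_i _.
have memE w : (w \in S) = (w^T <= U)%MS.
  apply/idP/idP => [/coord_vbasis wE | /submxP[c wE]].
    apply/submxP; exists (\row_i coord (vbasis S) i w).
    rewrite mulmx_sum_row {1}wE linear_sum; apply: eq_bigr => i _.
    by rewrite mxE rowK linearZ.
  rewrite -[w]trmxK wE mulmx_sum_row linear_sum memv_suml // => i _ /=.
  by rewrite linearZ /= rowK trmxK memvZ // vbasis_mem // mem_nth // size_tuple.
rewrite memE -[in RHS](inj_eq trmx_inj) trmx_mul trmxK.
by apply/idP/eqP => [/proj_ortho_id | <- //]; rewrite ?proj_ortho_sub.
Qed.

Lemma orthoproj_idem S : orthoproj S *m orthoproj S = orthoproj S.
Proof. by rewrite /orthoproj -trmx_mul proj_ortho_proj. Qed.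

Lemma orthoproj_herm S : (orthoproj S)^t* = orthoproj S.
Proof.
rewrite /orthoproj; set U := \matrix_i _; set P := proj_ortho U.
have orth : (1%:M - P) *m P^t* = 0.
  have := proj_ortho_compl_sub U 1%:M; rewrite mul1mx => PcU.
  have /submxP[D PE] : (P <= U)%MS by rewrite -[P]mul1mx proj_ortho_sub.
  move/orthomx1P: PcU => PcU.
  by rewrite PE trmx_mul map_mxM mulmxA -PE PcU mul0mx.
have PE : P^t* = P *m P^t*.
  by apply/eqP; rewrite -subr_eq0 -{1}[P^t*]mul1mx -mulmxBl orth.
have herm (X : 'M[C]_n) : X^t* = X *m X^t* -> X^t* = X.
  by move=> XE; rewrite -[RHS]trmxCK [in RHS]XE trmx_mul map_mxM trmxCK -XE.
by rewrite -{2}(herm P PE) trmxK map_trmx trmxK.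
Qed.

(* Only meaningful for subspaces of equal dimension. *)
Definition dist (S T : {vspace 'cV[C]_n}) : R :=
  mnorm2 (orthoproj S - orthoproj T).

Section SecondOrderKrylov.
Variables M N : 'M[C]_n.

(* The index is shifted by one: so_krylov_seq rm1 r0 i is r_(i-1). *)
Fixpoint so_krylov_seq (rm1 r0 : 'cV[C]_n) (i : nat) : 'cV[C]_n :=
  match i with
  | 0 => rm1
  | j.+1 => match j with
            | 0 => r0
            | l.+1 => M *m so_krylov_seq rm1 r0 j + N *m so_krylov_seq rm1 r0 l
            end
  end.

Definition so_krylov_space (k : nat) (rm1 r0 : 'cV[C]_n) : {vspace 'cV[C]_n} :=
  <<mkseq (so_krylov_seq rm1 r0) k.+1>>%VS.

Definition is_so_krylov (k : nat) (G : {vspace 'cV[C]_n}) : Prop :=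
  exists rm1 r0, G = so_krylov_space k rm1 r0.

Definition companion : 'M[C]_(n + n) := block_mx M N 1%:M 0.

End SecondOrderKrylov.
End Subspaces.

Section Toar.
Variable R : realType.
Local Notation C := R[i].

(* I_2 (x) X *)
Definition kron2 m d (X : 'M[C]_(m, d)) : 'M[C]_(m + m, d + d) :=
  block_mx X 0 0 X.

Definition upper_hessenberg m k (H : 'M[C]_(m, k)) : Prop :=
  forall (i : 'I_m) (j : 'I_k), (j.+1 < i)%N -> H i j = 0.

Definition working_orthonormal (c eps : R) m d (X : 'M[C]_(m, d)) : Prop :=
  \rank X = d /\ mnorm2 (X^t* *m X - 1%:M) <= c * eps.

Definition well_conditioned (c eps : R) m d (X : 'M[C]_(m, d)) : Prop :=
  exists2 Y, moore_penrose X Y &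
    `|mnorm2 X * mnorm2 Y - 1| <= c * eps.

(* Q is the matrix computed by k steps of TOAR applied to companion M N with
   unit roundoff eps, every O(eps) having constant c.  The run is represented by
   the properties guaranteed for the computed matrices, not by a trace of
   individual rounded operations. *)
Definition toar_computed (c eps : R) n (M N : 'M[C]_n) (k d : nat)
    (Q : 'M[C]_(n, d)) : Prop :=
  exists (q : 'cV[C]_n) (U1 U2 : 'M[C]_(d, k)) (x y : 'cV[C]_d) (beta : C)
         (H : 'M[C]_(k + 1, k)),
  let Q' : 'M[C]_(n, d + 1) := row_mx Q q in
  let U : 'M[C]_(d + d, k) := col_mx U1 U2 in
  let U1' : 'M[C]_(d + 1, k + 1) := block_mx U1 x 0 beta%:M in
  let U2' : 'M[C]_(d + 1, k + 1) := block_mx U2 y 0 0 in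
  let U' : 'M[C]_((d + 1) + (d + 1), k + 1) := col_mx U1' U2' in
  let Res := companion M N *m kron2 Q *m U - kron2 Q' *m U' *m H in
  [/\ (0 < k)%N, (d <= k.+1)%N & upper_hessenberg H] /\
  [/\ working_orthonormal c eps Q, working_orthonormal c eps Q',
      working_orthonormal c eps U & working_orthonormal c eps U'] /\
  [/\ well_conditioned c eps Q, well_conditioned c eps U &
      mnorm2 Res <= c * eps * mnorm2 (companion M N)].

End Toar.

(* Main.v *)
(* Scale to M = alpha A, N = alpha^2 B, so that |N| = 1, and let
   theta >= max (1, |M|).  The residual of the computed Arnoldi relation is
   absorbed into a perturbation D = O(eps theta) of the companion matrix, and a
   similarity within O(eps theta) of the identity restores the companion form;
   it moves colspace Q by O(eps theta), M by O(eps theta) and N by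
   O(eps theta^2).  The computed H may be reduced and [U2 y] may be rank
   deficient, but perturbing both by arbitrarily little, at the expense of the
   residual, makes colspace Q exactly the span of the second halves of the
   Arnoldi vectors.  If eps theta is not small, then colspace Q itself is a
   Krylov subspace of M and S^2 - M S for a small operator S that shifts the
   columns of Q, and S^2 - M S - N is within the allowed perturbation. *)

Require Import Defs.
From mathcomp Require Import all_boot all_order all_algebra.
From mathcomp Require Import boolp classical_sets reals.
From mathcomp Require Import complex ring lra.

Set Implicit Arguments.
Unset Strict Implicit.
Unset Printing Implicit Defensive.

Import Order.TTheory GRing.Theory Num.Theory.

Local Open Scope ring_scope.
Local Open Scope complex_scope.
Local Open Scope sesquilinear_scope.

(** * Inner product, Euclidean norm and spectral norm *)

Section Norms.
Variable R : realType.
Local Notation C := R[i].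

(* Only the real part of the Hermitian product is needed: it induces the same
   norm and the same adjoint. *)
Definition rdot n (u v : 'cV[C]_n) : R := complex.Re ((u^t* *m v) 0 0).

Lemma rdotE n (u v : 'cV[C]_n) : rdot u v =
  \sum_i (complex.Re (u i 0) * complex.Re (v i 0)
          + complex.Im (u i 0) * complex.Im (v i 0)).
Proof.
rewrite /rdot mxE raddf_sum; apply: eq_bigr => i _; rewrite !mxE.
by case: (u i 0) => a b; case: (v i 0) => e f /=; ring.
Qed.

Lemma rdotC n (u v : 'cV[C]_n) : rdot u v = rdot v u.
Proof. by rewrite !rdotE; apply: eq_bigr => i _; ring. Qed.

Lemma rdotDr n (u v w : 'cV[C]_n) : rdot u (v + w) = rdot u v + rdot u w.
Proof. by rewrite /rdot mulmxDr mxE raddfD. Qed.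

Lemma rdotNr n (u v : 'cV[C]_n) : rdot u (- v) = - rdot u v.
Proof. by rewrite /rdot mulmxN mxE raddfN. Qed.

Lemma rdotZr n (a : R) (u v : 'cV[C]_n) : rdot u (a%:C *: v) = a * rdot u v.
Proof.
rewrite /rdot -scalemxAr mxE.
by case: ((u^t* *m v) 0 0) => x y /=; ring.
Qed.

Lemma rdotDl n (u v w : 'cV[C]_n) : rdot (u + v) w = rdot u w + rdot v w.
Proof. by rewrite rdotC rdotDr !(rdotC w). Qed.

Lemma rdotNl n (u v : 'cV[C]_n) : rdot (- u) v = - rdot u v.
Proof. by rewrite rdotC rdotNr rdotC. Qed.

Lemma rdotZl n (a : R) (u v : 'cV[C]_n) : rdot (a%:C *: u) v = a * rdot u v.
Proof. by rewrite rdotC rdotZr rdotC. Qed.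

Lemma rdot_adj m n (X : 'M[C]_(m, n)) u v : rdot (X *m u) v = rdot u (X^t* *m v).
Proof. by rewrite /rdot trmx_mul map_mxM mulmxA. Qed.

Lemma vnorm2_ge0 n (v : 'cV[C]_n) : 0 <= vnorm2 v.
Proof. exact: sqrtr_ge0. Qed.

Lemma vnorm2_sqr n (v : 'cV[C]_n) : vnorm2 v ^+ 2 = rdot v v.
Proof.
rewrite sqr_sqrtr; last by apply: sumr_ge0 => i _; rewrite sqr_ge0.
rewrite rdotE; apply: eq_bigr => i _; case: (v i 0) => a b /=.
by rewrite sqr_sqrtr ?addr_ge0 ?sqr_ge0.
Qed.

Lemma rdot_ge0 n (v : 'cV[C]_n) : 0 <= rdot v v.
Proof. by rewrite -vnorm2_sqr sqr_ge0. Qed.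

Lemma vnorm2_0 n : vnorm2 (0 : 'cV[C]_n) = 0.
Proof. by apply/eqP; rewrite -sqrf_eq0 vnorm2_sqr /rdot mulmx0 mxE. Qed.

Lemma vnorm2_eq0 n (v : 'cV[C]_n) : (vnorm2 v == 0) = (v == 0).
Proof.
apply/eqP/eqP => [v0|->]; last exact: vnorm2_0.
apply/matrixP => i j; rewrite (ord1 j) mxE.
have : rdot v v = 0 by rewrite -vnorm2_sqr v0 expr0n.
rewrite rdotE => /eqP; rewrite psumr_eq0 => [/allP/(_ i)|k _]; last first.
  by rewrite addr_ge0 // -expr2 sqr_ge0.
rewrite mem_index_enum => /(_ isT) /=; case: (v i 0) => a b /=.
by rewrite -!expr2 paddr_eq0 ?sqr_ge0 // !sqrf_eq0 => /andP[/eqP-> /eqP->].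
Qed.

(** Cauchy-Schwarz without division: the squared norm of [(v.v) u - (u.v) v] expands to
    [(v.v) ((u.u) (v.v) - (u.v)^2)], and [v.v > 0]. *)
Lemma rdot_le n (u v : 'cV[C]_n) : rdot u v <= vnorm2 u * vnorm2 v.
Proof.
have [->|v0] := eqVneq v 0; first by rewrite vnorm2_0 mulr0 /rdot mulmx0 mxE.
have [uv0|uv0] := lerP (rdot u v) 0.
  by apply: le_trans uv0 _; rewrite mulr_ge0 ?vnorm2_ge0.
have nv : 0 < rdot v v.
  by rewrite -vnorm2_sqr exprn_gt0 // lt_def vnorm2_ge0 vnorm2_eq0 v0.
rewrite -ler_sqr ?nnegrE ?mulr_ge0 ?vnorm2_ge0 ?(ltW uv0) //.
rewrite exprMn !vnorm2_sqr.
have := rdot_ge0 ((rdot v v)%:C *: u - (rdot u v)%:C *: v).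
rewrite !(rdotDl, rdotDr, rdotNl, rdotNr, rdotZl, rdotZr) (rdotC v u).
move: (rdot u u) (rdot v v) (rdot u v) nv => a b e b0 h.
have : 0 <= b * (a * b - e ^+ 2).
  by apply: le_trans h _; rewrite le_eqVlt; apply/orP; left; apply/eqP; ring.
by rewrite pmulr_rge0 // subr_ge0.
Qed.

Lemma vnorm2D n (u v : 'cV[C]_n) : vnorm2 (u + v) <= vnorm2 u + vnorm2 v.
Proof.
rewrite -ler_sqr ?nnegrE ?addr_ge0 ?vnorm2_ge0 // sqrrD !vnorm2_sqr.
rewrite rdotDl !rdotDr (rdotC v u) mulr2n; move: (rdot_le u v).
by move: (rdot u v) (_ * _) (rdot u u) (rdot v v) => a b e f; lra.
Qed.

Lemma vnorm2Z n a (v : 'cV[C]_n) : vnorm2 (a *: v) = Normc.normc a * vnorm2 v.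
Proof.
rewrite /vnorm2.
have a0 : 0 <= Normc.normc a by case: a => ? ?; exact: sqrtr_ge0.
rewrite -(ger0_norm a0) -sqrtr_sqr -sqrtrM ?sqr_ge0 // mulr_sumr.
by congr Num.sqrt; apply: eq_bigr => i _; rewrite mxE Normc.normcM exprMn.
Qed.

Lemma normc_real (a : R) : Normc.normc a%:C = `|a|.
Proof. by rewrite /= expr0n addr0 sqrtr_sqr. Qed.

Lemma vnorm2ZR n (a : R) (v : 'cV[C]_n) : vnorm2 (a%:C *: v) = `|a| * vnorm2 v.
Proof. by rewrite vnorm2Z normc_real. Qed.

Lemma vnorm2N n (v : 'cV[C]_n) : vnorm2 (- v) = vnorm2 v.
Proof.
by rewrite -scaleN1r -(rmorphN1 (real_complex R)) vnorm2ZR normrN1 mul1r.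
Qed.

Lemma vnorm2_coord n (v : 'cV[C]_n) i : Normc.normc (v i 0) <= vnorm2 v.
Proof.
have a0 : 0 <= Normc.normc (v i 0) by case: (v i 0) => ? ?; exact: sqrtr_ge0.
rewrite -(ger0_norm a0) -sqrtr_sqr /vnorm2 ler_wsqrtr // (bigD1 i) //=.
by rewrite lerDl sumr_ge0 // => j _; rewrite sqr_ge0.
Qed.

Lemma vnorm2_col_mx m n (u : 'cV[C]_m) (v : 'cV[C]_n) :
  vnorm2 (col_mx u v) ^+ 2 = vnorm2 u ^+ 2 + vnorm2 v ^+ 2.
Proof.
rewrite !vnorm2_sqr !rdotE big_split_ord /=.
by congr (_ + _); apply: eq_bigr => i _; rewrite ?(col_mxEu, col_mxEd).
Qed.

Lemma vnorm2_le_col_mxl m n (u : 'cV[C]_m) (v : 'cV[C]_n) :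
  vnorm2 u <= vnorm2 (col_mx u v).
Proof.
by rewrite -ler_sqr ?nnegrE ?vnorm2_ge0 // vnorm2_col_mx lerDl sqr_ge0.
Qed.

Lemma vnorm2_le_col_mxr m n (u : 'cV[C]_m) (v : 'cV[C]_n) :
  vnorm2 v <= vnorm2 (col_mx u v).
Proof.
by rewrite -ler_sqr ?nnegrE ?vnorm2_ge0 // vnorm2_col_mx lerDr sqr_ge0.
Qed.

Lemma vnorm2_col_mx_le m n (u : 'cV[C]_m) (v : 'cV[C]_n) :
  vnorm2 (col_mx u v) <= vnorm2 u + vnorm2 v.
Proof.
rewrite -ler_sqr ?nnegrE ?addr_ge0 ?vnorm2_ge0 // vnorm2_col_mx sqrrD mulr2n.
by have := mulr_ge0 (vnorm2_ge0 u) (vnorm2_ge0 v); lra.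
Qed.

(** A crude bound by the sum of the column norms; it ensures that the [sup] defining [mnorm2] is
    taken over a bounded set. *)
Lemma mulmx_bounded m n (X : 'M[C]_(m, n)) :
  exists2 b : R, 0 <= b & forall v, vnorm2 (X *m v) <= b * vnorm2 v.
Proof.
exists (\sum_j vnorm2 (col j X)).
  by apply: sumr_ge0 => j _; exact: vnorm2_ge0.
move=> v.
have -> : X *m v = \sum_j v j 0 *: col j X.
  apply/colP => i; rewrite mxE summxE; apply: eq_bigr => j _.
  by rewrite !mxE mulrC.
rewrite mulr_suml; elim/big_ind2: _ => [|u a w b ua wb|j _].
- by rewrite vnorm2_0.
- by apply: le_trans (vnorm2D _ _) _; exact: lerD.
- by rewrite vnorm2Z mulrC ler_wpM2l ?vnorm2_ge0 // vnorm2_coord.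
Qed.

Lemma mnorm2_has_sup m n (X : 'M[C]_(m, n)) :
  has_sup [set vnorm2 (X *m v) | v in [set v : 'cV_n | vnorm2 v <= 1]]%classic.
Proof.
split; first by exists (vnorm2 (X *m 0)), 0 => //=; rewrite vnorm2_0.
have [b b0 Xb] := mulmx_bounded X; exists b => _ [v /= v1 <-].
by apply: le_trans (Xb v) _; rewrite ler_piMr.
Qed.

Lemma mnorm2_ge0 m n (X : 'M[C]_(m, n)) : 0 <= mnorm2 X.
Proof.
have [_ /ub_le_sup] := mnorm2_has_sup X; apply.
by exists 0 => /=; rewrite ?mulmx0 vnorm2_0.
Qed.

Lemma vnorm2M m n (X : 'M[C]_(m, n)) v : vnorm2 (X *m v) <= mnorm2 X * vnorm2 v.
Proof.
have [->|v0] := eqVneq v 0; first by rewrite mulmx0 !vnorm2_0 mulr0.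
have nv : 0 < vnorm2 v by rewrite lt_def vnorm2_ge0 vnorm2_eq0 v0.
rewrite -ler_pdivrMr //.
have [_ /ub_le_sup] := mnorm2_has_sup X; apply.
exists (((vnorm2 v)^-1)%:C *: v) => /=.
  by rewrite vnorm2ZR ger0_norm ?invr_ge0 ?(ltW nv) // mulVf ?gt_eqF.
by rewrite -scalemxAr vnorm2ZR ger0_norm ?invr_ge0 ?(ltW nv) // mulrC.
Qed.

Lemma mnorm2_le m n (X : 'M[C]_(m, n)) b : 0 <= b ->
  (forall v, vnorm2 (X *m v) <= b * vnorm2 v) -> mnorm2 X <= b.
Proof.
move=> b0 Xb; apply: ge_sup; first by case: (mnorm2_has_sup X).
move=> _ [v /= v1 <-]; apply: le_trans (Xb v) _.
by rewrite ler_piMr.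
Qed.

Lemma mnorm2_0 m n : mnorm2 (0 : 'M[C]_(m, n)) = 0.
Proof.
apply/eqP; rewrite eq_le mnorm2_ge0 andbT mnorm2_le // => v.
by rewrite mul0mx vnorm2_0 mul0r.
Qed.

Lemma mnorm2_eq0 m n (X : 'M[C]_(m, n)) : (mnorm2 X == 0) = (X == 0).
Proof.
apply/eqP/eqP => [X0|->]; last exact: mnorm2_0.
apply/matrixP => i j; have := vnorm2M X (delta_mx j 0).
rewrite X0 mul0r -colE => h.
have /eqP : vnorm2 (col j X) = 0 by apply/eqP; rewrite eq_le h vnorm2_ge0.
by rewrite vnorm2_eq0 => /eqP/colP/(_ i); rewrite !mxE.
Qed.

Lemma mnorm2D m n (X Y : 'M[C]_(m, n)) : mnorm2 (X + Y) <= mnorm2 X + mnorm2 Y.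
Proof.
apply: mnorm2_le => [|v]; first by rewrite addr_ge0 ?mnorm2_ge0.
by rewrite mulmxDl mulrDl; apply: le_trans (vnorm2D _ _) _; rewrite lerD ?vnorm2M.
Qed.

Lemma mnorm2M m n p (X : 'M[C]_(m, n)) (Y : 'M[C]_(n, p)) :
  mnorm2 (X *m Y) <= mnorm2 X * mnorm2 Y.
Proof.
apply: mnorm2_le => [|v]; first by rewrite mulr_ge0 ?mnorm2_ge0.
rewrite -mulmxA -mulrA; apply: le_trans (vnorm2M _ _) _.
by rewrite ler_wpM2l ?mnorm2_ge0 ?vnorm2M.
Qed.

Lemma mnorm2N m n (X : 'M[C]_(m, n)) : mnorm2 (- X) = mnorm2 X.
Proof.
apply/eqP; rewrite eq_le; apply/andP; split.
  by apply: mnorm2_le => [|v]; rewrite ?mnorm2_ge0 // mulNmx vnorm2N vnorm2M.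
apply: mnorm2_le => [|v]; first exact: mnorm2_ge0.
by rewrite -vnorm2N -mulNmx vnorm2M.
Qed.

Lemma mnorm2B m n (X Y : 'M[C]_(m, n)) : mnorm2 (X - Y) <= mnorm2 X + mnorm2 Y.
Proof. by rewrite -(mnorm2N Y) mnorm2D. Qed.

Lemma mnorm2ZR_le m n (a : R) (X : 'M[C]_(m, n)) :
  mnorm2 (a%:C *: X) <= `|a| * mnorm2 X.
Proof.
apply: mnorm2_le => [|v]; first by rewrite mulr_ge0 ?mnorm2_ge0.
by rewrite -scalemxAl vnorm2ZR -mulrA ler_wpM2l ?vnorm2M.
Qed.

Lemma mnorm2ZR m n (a : R) (X : 'M[C]_(m, n)) :
  mnorm2 (a%:C *: X) = `|a| * mnorm2 X.
Proof.
have [->|a0] := eqVneq a 0; first by rewrite normr0 mul0r scale0r mnorm2_0.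
apply/eqP; rewrite eq_le mnorm2ZR_le andTb.
have {1}-> : X = (a^-1)%:C *: (a%:C *: X).
  by rewrite scalerA -rmorphM mulVf // scale1r.
rewrite mulrC -ler_pdivlMr ?normr_gt0 // mulrC -normfV.
exact: mnorm2ZR_le.
Qed.

Lemma mnorm2_1 n : mnorm2 (1%:M : 'M[C]_n) <= 1.
Proof. by apply: mnorm2_le => // v; rewrite mul1mx mul1r. Qed.

(** With [w = X^t* v], moving the adjoint across the inner product and Cauchy-Schwarz give
    [|w|^2 <= |X| |w| |v|]; cancel [|w|]. *)
Lemma mnorm2_adj m n (X : 'M[C]_(m, n)) : mnorm2 (X^t*) <= mnorm2 X.
Proof.
apply: mnorm2_le => [|v]; first exact: mnorm2_ge0.
have [w0|w0] := eqVneq (vnorm2 (X^t* *m v)) 0.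
  by rewrite w0 mulr_ge0 ?mnorm2_ge0 ?vnorm2_ge0.
have w1 : 0 < vnorm2 (X^t* *m v) by rewrite lt_def w0 vnorm2_ge0.
rewrite -(ler_pM2l w1) -expr2 vnorm2_sqr -rdot_adj.
apply: le_trans (rdot_le _ _) _; rewrite mulrA ler_wpM2r ?vnorm2_ge0 // mulrC.
exact: vnorm2M.
Qed.

Lemma mnorm2_usubmx m1 m2 p (Y : 'M[C]_(m1 + m2, p)) : mnorm2 (usubmx Y) <= mnorm2 Y.
Proof.
apply: mnorm2_le => [|v]; first exact: mnorm2_ge0.
apply: le_trans (vnorm2M Y v); rewrite -{2}(vsubmxK Y) mul_col_mx.
exact: vnorm2_le_col_mxl.
Qed.

Lemma mnorm2_dsubmx m1 m2 p (Y : 'M[C]_(m1 + m2, p)) : mnorm2 (dsubmx Y) <= mnorm2 Y.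
Proof.
apply: mnorm2_le => [|v]; first exact: mnorm2_ge0.
apply: le_trans (vnorm2M Y v); rewrite -{2}(vsubmxK Y) mul_col_mx.
exact: vnorm2_le_col_mxr.
Qed.

Lemma mnorm2_lsubmx n1 n2 p (Y : 'M[C]_(p, n1 + n2)) : mnorm2 (lsubmx Y) <= mnorm2 Y.
Proof.
apply: mnorm2_le => [|v]; first exact: mnorm2_ge0.
have -> : lsubmx Y *m v = Y *m col_mx v 0.
  by rewrite -{2}(hsubmxK Y) mul_row_col mulmx0 addr0.
apply: le_trans (vnorm2M _ _) _; rewrite ler_wpM2l ?mnorm2_ge0 //.
by apply: le_trans (vnorm2_col_mx_le _ _) _; rewrite vnorm2_0 addr0.
Qed.

Lemma mnorm2_rsubmx n1 n2 p (Y : 'M[C]_(p, n1 + n2)) : mnorm2 (rsubmx Y) <= mnorm2 Y.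
Proof.
apply: mnorm2_le => [|v]; first exact: mnorm2_ge0.
have -> : rsubmx Y *m v = Y *m col_mx 0 v.
  by rewrite -{2}(hsubmxK Y) mul_row_col mulmx0 add0r.
apply: le_trans (vnorm2M _ _) _; rewrite ler_wpM2l ?mnorm2_ge0 //.
by apply: le_trans (vnorm2_col_mx_le _ _) _; rewrite vnorm2_0 add0r.
Qed.

Lemma mnorm2_companion n (M N : 'M[C]_n) :
  mnorm2 (companion M N) <= mnorm2 M + mnorm2 N + 1.
Proof.
apply: mnorm2_le => [|v]; first by rewrite !addr_ge0 ?mnorm2_ge0.
rewrite -[v]vsubmxK; set v1 := usubmx v; set v2 := dsubmx v.
rewrite /companion mul_block_col mul1mx mul0mx addr0.
apply: le_trans (vnorm2_col_mx_le _ _) _; rewrite !mulrDl mul1r.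
apply: lerD; last exact: vnorm2_le_col_mxl.
apply: le_trans (vnorm2D _ _) _; apply: lerD; apply: le_trans (vnorm2M _ _) _.
  by rewrite ler_wpM2l ?mnorm2_ge0 ?vnorm2_le_col_mxl.
by rewrite ler_wpM2l ?mnorm2_ge0 ?vnorm2_le_col_mxr.
Qed.

End Norms.

(** * Spans and nonsingular matrices over a field *)

Section LinearAlgebra.
Variable F : fieldType.

Lemma row_free_tr m n (X : 'M[F]_(m, n)) :
  (forall v : 'cV_n, X *m v = 0 -> v = 0) -> row_free X^T.
Proof.
move=> Xinj; rewrite -kermx_eq0; apply/rowV0P => u /sub_kermxP uX.
by apply: trmx_inj; rewrite trmx0; apply: Xinj; rewrite -[X]trmxK -trmx_mul uX trmx0.
Qed.

Lemma unitmx_inj n (X : 'M[F]_n) :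
  (forall v : 'cV_n, X *m v = 0 -> v = 0) -> X \in unitmx.
Proof. by move=> /row_free_tr; rewrite row_free_unit unitmx_tr. Qed.

Lemma span_scale (V : vectType F) (a : nat -> F) (f : nat -> V) k :
  (forall i, a i != 0) ->
  <<mkseq (fun i => a i *: f i) k>>%VS = <<mkseq f k>>%VS.
Proof.
move=> a0; apply/eqP; rewrite eqEsubv; apply/andP; split;
    apply/span_subvP => _ /mapP[i ik ->].
  by rewrite memvZ // memv_span // map_f.
have -> : f i = (a i)^-1 *: (a i *: f i) by rewrite scalerA mulVf // scale1r.
by rewrite memvZ // memv_span //; exact: (map_f (fun i => a i *: f i)).
Qed.

(** The relation puts [f (z j)] in the span of the first [j + 2] vectors, so induction gives one
    inclusion. Since [h j.+1 j] is nonzero, the relation can be solved for [z j.+1], and strong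
    induction gives the other. *)
Lemma arnoldi_span (V : vectType F) (f : 'End(V)) (z : nat -> V)
    (h : nat -> nat -> F) k :
  (forall j, (j < k)%N -> f (z j) = \sum_(i < j.+2) h i j *: z i) ->
  (forall j, (j < k)%N -> h j.+1 j != 0) ->
  <<mkseq (fun i => iter i f (z 0%N)) k.+1>>%VS = <<mkseq z k.+1>>%VS.
Proof.
move=> fz h0; pose y i := iter i f (z 0%N).
have mem (g : nat -> V) i j : (i <= j)%N -> g i \in <<mkseq g j.+1>>%VS.
  by move=> ij; apply/memv_span/map_f; rewrite mem_iota.
have sub (g : nat -> V) i j : (i <= j)%N ->
    (<<mkseq g i.+1>> <= <<mkseq g j.+1>>)%VS.
  move=> ij; apply/span_subvP => w /mapP[l]; rewrite mem_iota => li ->.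
  by apply: mem; apply: leq_trans ij.
have lim (g : nat -> V) (U : {vspace V}) i : (forall j, (j <= i)%N -> f (g j) \in U) ->
    forall v, v \in <<mkseq g i.+1>>%VS -> f v \in U.
  move=> gU v; have gf : (<<mkseq g i.+1>> <= f @^-1: U)%VS.
    apply/span_subvP => w /mapP[l]; rewrite mem_iota => li ->.
    by rewrite -memv_preim gU.
  by move=> /(subvP gf); rewrite -memv_preim.
have yz i : (i <= k)%N -> y i \in <<mkseq z i.+1>>%VS.
  elim: i => [|i IH] ik; first exact: (mem z 0%N 0%N).
  apply: (lim z _ i) (IH (ltnW ik)) => j ji.
  rewrite fz; last exact: leq_ltn_trans ik.
  apply: memv_suml => l _; apply/memvZ/mem.
  by have := ltn_ord l; rewrite ltnS => /leq_trans; apply.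
have zy i : (i <= k)%N -> z i \in <<mkseq y i.+1>>%VS.
  elim/ltn_ind: i => i; case: i => [|i] IH ik; first exact: (mem y 0%N 0%N).
  have -> : z i.+1 = (h i.+1 i)^-1 *: (f (z i) - \sum_(j < i.+1) h j i *: z j).
    by rewrite fz // big_ord_recr addrC addKr scalerA mulVf ?scale1r ?h0.
  rewrite memvZ // memvB //.
    apply: (lim y _ i) (IH i _ (ltnW ik)) => // j ji.
    by apply: (mem y j.+1).
  apply: memv_suml => l _; apply: memvZ.
  have := ltn_ord l; rewrite ltnS => li.
  apply: (subvP (sub y l i.+1 (leqW li))); apply: IH; rewrite ?ltnS //.
  by rewrite (leq_trans li) // ltnW.
apply/eqP; rewrite eqEsubv; apply/andP; split;
    apply/span_subvP => w /mapP[l]; rewrite mem_iota => li ->.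
  by apply: (subvP (sub z l k li)); apply: yz.
by apply: (subvP (sub y l k li)); apply: zy.
Qed.

(** If [A + t] is singular, then [t] is a root of the characteristic polynomial of [- A], which has
    at most [d] roots. *)
Lemma char_poly_avoid d (A : 'M[F]_d) (s : seq F) :
  uniq s -> (d < size s)%N -> exists2 t, t \in s & A + t%:M \in unitmx.
Proof.
move=> us ds; apply: contrapT => noT.
have roots : all (root (char_poly (- A))) s.
  apply/allP => t ts; rewrite -eigenvalue_root_char.
  apply: contrapT => tE; apply: noT; exists t => //.
  rewrite -row_free_unit -kermx_eq0; apply/rowV0P => u /sub_kermxP.
  rewrite mulmxDr mul_mx_scalar => /eqP; rewrite addrC addr_eq0 => /eqP uA.
  apply/eqP/negPn/negP => u0; apply: tE.
  by apply/eigenvalueP; exists u; rewrite // mulmxN uA.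
have := max_poly_roots (monic_neq0 (char_poly_monic (- A))) roots us.
by rewrite size_char_poly ltnS leqNgt ds.
Qed.

End LinearAlgebra.

(** * Bounded inverses, distance of subspaces, and scaling of Krylov sequences *)

Section Complex.
Variable R : realType.
Local Notation C := R[i].

(** The left inverse is the pseudoinverse, formed from the Gram matrix [G]. Composed with [X] it is
    an orthogonal projection, hence a contraction, and the lower bound on [X] is then divided
    out. *)
Lemma left_inverse_bound m n (X : 'M[C]_(m, n)) (a : R) : 0 < a ->
  (forall v, a * vnorm2 v <= vnorm2 (X *m v)) ->
  exists2 L, L *m X = 1%:M & mnorm2 L <= a^-1.
Proof.
move=> a0 Xa; pose G := X^t* *m X.
have Xinj (v : 'cV_n) : X *m v = 0 -> v = 0.
  move=> Xv; apply/eqP; rewrite -vnorm2_eq0 eq_le vnorm2_ge0 andbT.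
  by rewrite -(ler_pM2l a0) mulr0; have := Xa v; rewrite Xv vnorm2_0.
have Gu : G \in unitmx.
  apply: unitmx_inj => v Gv; apply: Xinj; apply/eqP.
  rewrite -vnorm2_eq0 -sqrf_eq0 vnorm2_sqr rdot_adj mulmxA Gv.
  by rewrite /rdot mulmx0 mxE.
exists (invmx G *m X^t*); first by rewrite -mulmxA mulVmx.
apply: mnorm2_le => [|w]; first by rewrite invr_ge0 ltW.
set u := _ *m w.
rewrite mulrC ler_pdivlMr // mulrC; apply: le_trans (Xa u) _.
have [->|p0] := eqVneq (vnorm2 (X *m u)) 0; first exact: vnorm2_ge0.
have p1 : 0 < vnorm2 (X *m u) by rewrite lt_def p0 vnorm2_ge0.
(* X u is the orthogonal projection of w onto the range of X. *)
rewrite -(ler_pM2l p1) -expr2 vnorm2_sqr.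
suff -> : rdot (X *m u) (X *m u) = rdot (X *m u) w by exact: rdot_le.
rewrite rdot_adj [RHS]rdot_adj; congr (rdot _ _).
by rewrite mulmxA -/G /u -(mulmxA (invmx G)) mulKVmx.
Qed.

(** By the triangle inequality [1 + E] shrinks no vector by more than a factor 2, and a left inverse
    of a square matrix is its inverse. *)
Lemma inverse_bound n (E : 'M[C]_n) : mnorm2 E <= 2^-1 ->
  1%:M + E \in unitmx /\ mnorm2 (invmx (1%:M + E)) <= 2.
Proof.
move=> Eh; have Xa v : 2^-1 * vnorm2 v <= vnorm2 ((1%:M + E) *m v).
  have := vnorm2D ((1%:M + E) *m v) (- (E *m v)).
  rewrite mulmxDl mul1mx addrK vnorm2N.
  have := ler_wpM2r (vnorm2_ge0 v) Eh; have := vnorm2M E v.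
  move: (vnorm2 (E *m v)) (vnorm2 v) (vnorm2 _) (mnorm2 E * _) => a b e f.
  lra.
have [|L LX Lb] := left_inverse_bound _ Xa; first by rewrite invr_gt0.
rewrite invrK in Lb.
have Xu : 1%:M + E \in unitmx by case: (mulmx1_unit LX).
split; first exact: Xu.
by have := mulmxK Xu L; rewrite LX mul1mx => ->; exact: Lb.
Qed.

Lemma colspaceP n d (Q : 'M[C]_(n, d)) v :
  reflect (exists c, v = Q *m c) (v \in colspace Q).
Proof.
apply: (iffP idP) => [|[c ->]].
  have QS : (colspace Q <= limg (linfun (mulmx Q : 'cV_d -> 'cV_n)))%VS.
    apply/span_subvP => _ /mapP[j _ ->].
    by rewrite colE -[Q *m _]lfunE memv_img ?memvf.
  by move=> /(subvP QS)/memv_imgP[c _ ->]; exists c; rewrite lfunE.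
have -> : Q *m c = \sum_j c j 0 *: col j Q.
  apply/colP => i; rewrite mxE summxE; apply: eq_bigr => j _.
  by rewrite !mxE mulrC.
by apply: memv_suml => j _; rewrite memvZ // memv_span // fintype.image_f.
Qed.

(** The difference of projectors [P - P'] is [(1 - P') P] minus the adjoint of [(1 - P) P']. Each
    term is a one-sided gap, controlled by one of the two approximation hypotheses because the
    orthogonal projection is the best approximation. *)
Lemma dist_le n (S T : {vspace 'cV[C]_n}) (a b : R) : 0 <= a -> 0 <= b ->
  (forall v, v \in S -> exists2 w, w \in T & vnorm2 (v - w) <= a * vnorm2 v) ->
  (forall w, w \in T -> exists2 v, v \in S & vnorm2 (w - v) <= b * vnorm2 w) ->
  dist S T <= a + b.
Proof.
have pdot (U : {vspace 'cV[C]_n}) (u v : 'cV[C]_n) : u \in U ->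
    rdot u (v - orthoproj U *m v) = 0.
  rewrite orthoproj_mem => /eqP <-.
  rewrite rdot_adj orthoproj_herm mulmxBr mulmxA orthoproj_idem subrr.
  by rewrite /rdot mulmx0 mxE.
have pmem (U : {vspace 'cV[C]_n}) (v : 'cV[C]_n) : orthoproj U *m v \in U.
  by rewrite orthoproj_mem mulmxA orthoproj_idem.
have pyth (U : {vspace 'cV[C]_n}) (u v : 'cV[C]_n) : u \in U ->
    vnorm2 (v - orthoproj U *m v) ^+ 2 + vnorm2 (u - orthoproj U *m v) ^+ 2
    = vnorm2 (v - u) ^+ 2.
  move=> uU; have pU := pdot U _ v (memvB (pmem U v) uU).
  have -> : v - u = (v - orthoproj U *m v) + (orthoproj U *m v - u).
    by rewrite addrA subrK.
  rewrite -(vnorm2N (u - _)) opprB !vnorm2_sqr.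
  move: (v - _) (_ - u) pU => x y yx.
  by rewrite rdotDl !rdotDr (rdotC x y) yx addr0 add0r.
have best (U : {vspace 'cV[C]_n}) (u v : 'cV[C]_n) : u \in U ->
    vnorm2 (v - orthoproj U *m v) <= vnorm2 (v - u).
  move=> /(pyth U _ v) e; rewrite -ler_sqr ?nnegrE ?vnorm2_ge0 // -e.
  by rewrite lerDl sqr_ge0.
have contr (U : {vspace 'cV[C]_n}) v : vnorm2 (orthoproj U *m v) <= vnorm2 v.
  have := pyth U 0 v (mem0v _); rewrite subr0 sub0r vnorm2N => e.
  by rewrite -ler_sqr ?nnegrE ?vnorm2_ge0 // -e lerDr sqr_ge0.
have gap (U V : {vspace 'cV[C]_n}) e : 0 <= e ->
    (forall v, v \in U -> exists2 w, w \in V & vnorm2 (v - w) <= e * vnorm2 v) ->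
    mnorm2 ((1%:M - orthoproj V) *m orthoproj U) <= e.
  move=> e0 UV; apply: mnorm2_le => // v.
  rewrite -mulmxA mulmxBl mul1mx.
  have [w wV wb] := UV _ (pmem U v).
  apply: le_trans (best V w _ wV) _; apply: le_trans wb _.
  by rewrite ler_wpM2l.
move=> a0 b0 ST TS; rewrite /dist.
set P := orthoproj S; set P' := orthoproj T.
have -> : P - P' = (1%:M - P') *m P - ((1%:M - P) *m P')^t*.
  rewrite trmx_mul map_mxM orthoproj_herm linearB /= trmx1 map_mxB map_mx1.
  by rewrite orthoproj_herm mulmxBl mulmxBr mul1mx mulmx1 opprB addrA subrK.
apply: le_trans (mnorm2B _ _) _; apply: lerD; first exact: gap.
by apply: le_trans (mnorm2_adj _) _; exact: gap.
Qed.

(** The vector at position [i] is multiplied by [a ^+ i], which leaves the span unchanged. *)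
Lemma so_krylov_scale n (M N : 'M[C]_n) (a : C) k rm1 r0 : a != 0 ->
  so_krylov_space (a *: M) (a ^+ 2 *: N) k rm1 (a *: r0)
  = so_krylov_space M N k rm1 r0.
Proof.
move=> a0; pose r := so_krylov_seq M N rm1 r0.
rewrite /so_krylov_space -(@span_scale _ _ (fun i => a ^+ i) r); last first.
  by move=> i; rewrite expf_neq0.
congr <<_>>%VS; apply: eq_map => i.
(* The recurrence has two terms, so the induction carries two consecutive indices. *)
suff : so_krylov_seq (a *: M) (a ^+ 2 *: N) rm1 (a *: r0) i = a ^+ i *: r i /\
       so_krylov_seq (a *: M) (a ^+ 2 *: N) rm1 (a *: r0) i.+1
       = a ^+ i.+1 *: r i.+1 by case.
elim: i => [|i [IH0 IH1]]; first by rewrite expr0 expr1 scale1r.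
split => //; rewrite [LHS]/= -/(so_krylov_seq _ _ _ _ i.+1) IH1.
rewrite -/(so_krylov_seq _ _ _ _ i) IH0.
rewrite -!scalemxAl -!scalemxAr !scalerA -exprS -exprD add2n.
by rewrite -scalerDr.
Qed.

Lemma is_so_krylov_scale n (M N : 'M[C]_n) (a : C) k G : a != 0 ->
  is_so_krylov (a *: M) (a ^+ 2 *: N) k G -> is_so_krylov M N k G.
Proof.
move=> a0 [rm1 [r0 ->]]; exists rm1, (a^-1 *: r0).
by rewrite -[RHS](so_krylov_scale _ _ _ _ _ a0) scalerA mulfV // scale1r.
Qed.

End Complex.

(** * Krylov subspaces from exact Hessenberg relations, and generic rank *)

Section Core.
Variable R : realType.
Local Notation C := R[i].

(** Matrix form of [arnoldi_span]: [pid_mx k] selects the first [k] columns of [Z]. The equation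
    [m = k.+1] is a hypothesis so that the lemma applies to matrices of size [k + 1]. *)
Lemma hessenberg_span p k m (A : 'M[C]_p) (Z : 'M[C]_(p, m)) (H : 'M[C]_(m, k)) :
  m = k.+1 -> upper_hessenberg H ->
  (forall (i : 'I_m) (j : 'I_k), i = j.+1 :> nat -> H i j != 0) ->
  A *m (Z *m pid_mx k) = Z *m H ->
  exists z0, colspace Z
    = <<mkseq (fun i => iter i (linfun (mulmx A : 'cV_p -> 'cV_p)) z0) k.+1>>%VS.
Proof.
move=> em; subst m => Hh Hn AZ.
(* [z] and [h] extend the columns of [Z] and the entries of [H] to all natural indices; only
   [i <= k] and [j < k] matter below. *)
pose z (i : nat) := col (inord i : 'I_k.+1) Z.
pose h (i j : nat) := \sum_(l < k | l == j :> nat) H (inord i) l.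
have hE i (j : 'I_k) : h i j = H (inord i) j by rewrite /h (big_pred1 j).
exists (z 0%N); rewrite (@arnoldi_span _ _ _ z h).
- congr <<_>>%VS; rewrite /image_mem /mkseq -val_enum_ord -map_comp.
  by apply: eq_map => i /=; rewrite /z inord_val.
- move=> j jk; pose j' := Ordinal jk.
  have -> : z j = (Z *m pid_mx k) *m delta_mx j' 0.
    rewrite -mulmxA /z colE; congr (_ *m _); apply/colP => i.
    rewrite -colE !mxE eqxx andbT -(inj_eq val_inj) /= inordK ?ltnS ?(ltnW jk) //.
    by case: eqP => // ->; rewrite jk.
  rewrite lfunE /= mulmxA AZ -mulmxA -colE.
  have -> : Z *m col j' H = \sum_(i < k.+1) h i j *: z i.
    apply/colP => a; rewrite mxE summxE; apply: eq_bigr => i _.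
    by rewrite !mxE (hE i j') inord_val mulrC.
  rewrite [RHS](big_ord_widen k.+1 (fun i => h i j *: z i)) //.
  rewrite [LHS](bigID (fun i : 'I__ => (i < j.+2)%N)) /=.
  rewrite [X in _ + X]big1 ?addr0 // => i; rewrite -leqNgt => ji.
  by rewrite (hE i j') Hh ?scale0r // inord_val.
- move=> j jk; rewrite (hE _ (Ordinal jk)) Hn //= inordK //.
Qed.

Lemma companion_iter n (M N : 'M[C]_n) (w : 'cV[C]_(n + n)) i :
  iter i (linfun (mulmx (companion M N) : 'cV_(n + n) -> 'cV_(n + n))) w
  = col_mx (so_krylov_seq M N (dsubmx w) (usubmx w) i.+1)
           (so_krylov_seq M N (dsubmx w) (usubmx w) i).
Proof.
elim: i => [|i IH]; first by rewrite /= vsubmxK.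
by rewrite [LHS]/= IH lfunE /= mul_block_col mul1mx mul0mx addr0.
Qed.

Lemma dsubmx_colspace p q m (Z : 'M[C]_(p + q, m)) :
  (linfun (dsubmx : 'cV[C]_(p + q) -> 'cV[C]_q) @: colspace Z)%VS
  = colspace (dsubmx Z).
Proof.
rewrite limg_span; congr <<_>>%VS; rewrite -map_comp; apply: eq_map => j /=.
by rewrite lfunE; apply/colP => i; rewrite !mxE.
Qed.

(** The columns of [Z] span the same space as the iterates of the companion matrix, and the lower
    halves of these iterates are the second-order Krylov vectors. *)
Lemma companion_span n k m (M N : 'M[C]_n) (Z : 'M[C]_(n + n, m))
    (H : 'M[C]_(m, k)) :
  m = k.+1 -> upper_hessenberg H ->
  (forall (i : 'I_m) (j : 'I_k), i = j.+1 :> nat -> H i j != 0) ->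
  companion M N *m (Z *m pid_mx k) = Z *m H ->
  is_so_krylov M N k (colspace (dsubmx Z)).
Proof.
move=> em Hh Hn /(hessenberg_span em Hh Hn)[z0 ZE].
exists (dsubmx z0), (usubmx z0); rewrite -dsubmx_colspace ZE limg_span.
congr <<_>>%VS; rewrite /mkseq -map_comp; apply: eq_map => i.
by rewrite /= companion_iter lfunE /= col_mxKd.
Qed.

(** Multiplying by the transpose of [J] gives the square matrix [V J^T + t]. Of the [d + 1] distinct
    candidates [b / (i + 1)] for [t], at least one makes it nonsingular, which yields the right
    inverse. *)
Lemma full_rank_perturbation d m (V : 'M[C]_(d, m))
    (J := pid_mx d : 'M[C]_(d, m)) (b : R) :
  (d <= m)%N -> 0 < b ->
  exists2 t : R, 0 < t <= b & exists W, (V + t%:C *: J) *m W = 1%:M.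
Proof.
move=> dm b0; pose s := mkseq (fun i => (b / i.+1%:R)%:C) d.+1.
have us : uniq s.
  rewrite mkseq_uniq // => i j [] /(mulfI (lt0r_neq0 b0))/invr_inj/eqP.
  by rewrite eqr_nat => /eqP[].
have [|_ /mapP[i _ ->] tu] := @char_poly_avoid _ _ (V *m J^T) s us.
  by rewrite size_mkseq.
exists (b / i.+1%:R).
  by rewrite divr_gt0 ?ltr0n //= ler_pdivrMr ?ltr0n // ler_peMr ?ler1n ?ltW.
rewrite /J tr_pid_mx in tu.
exists (pid_mx d *m invmx (V *m pid_mx d + (b / i.+1%:R)%:C%:M)).
rewrite mulmxA mulmxDl -scalemxAl /J mul_pid_mx minnn (minn_idPr dm).
by rewrite pid_mx_1 scalemx1 mulmxV.
Qed.

End Core.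

(* Conjugation by [1, X^-1 Y; 0, X^-1] turns [M, N; X, Y] back into a
   companion matrix. *)
Lemma companion_similarity (K : fieldType) n k m (M N X Y : 'M[K]_n)
    (f p : 'M[K]_(n, k)) (F P : 'M[K]_(n, m)) (H : 'M[K]_(m, k))
    (T := invmx X *m Y *m X) :
  X \in unitmx -> M *m f + N *m p = F *m H -> X *m f + Y *m p = P *m H ->
  (M + T) *m (f + invmx X *m Y *m p) + (N *m X - M *m T) *m (invmx X *m p)
  = (F + invmx X *m Y *m P) *m H.
Proof.
move=> Xu eqF eqP; rewrite [RHS]mulmxDl -eqF -(mulmxA _ P H) -eqP.
have TX (w : 'M_(n, k)) : T *m (invmx X *m w) = invmx X *m Y *m w.
  by rewrite /T -!mulmxA mulKVmx.
have Tf : T *m f = invmx X *m Y *m (X *m f) by rewrite [RHS]mulmxA.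
have Tp : T *m (invmx X *m Y *m p) = invmx X *m Y *m (Y *m p).
  by rewrite -[invmx X *m Y *m p]mulmxA TX.
rewrite mulmxBl -(mulmxA _ X) mulKVmx // -(mulmxA _ T) TX.
rewrite mulmxDl !(mulmxDr M) (mulmxDr T) Tf Tp -(mulmxDr (invmx X *m Y)).
by rewrite addrAC addrACA subrr addr0.
Qed.

(** * Structured backward error of a perturbed companion relation *)

Section Backward.
Variable R : realType.
Local Notation C := R[i].

(** A bounded left inverse of the first [k] columns of [Z] turns the residual into a perturbation of
    the whole companion matrix; [companion_similarity] then restores the companion form and replaces
    [P] by [X^-1 P] with [X = 1 + E]. *)
Lemma structured_backward_error n k m (M N : 'M[C]_n) (F P : 'M[C]_(n, m))
    (H : 'M[C]_(m, k)) (theta e : R) (Z := col_mx F P) :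
  m = k.+1 -> upper_hessenberg H ->
  (forall (i : 'I_m) (j : 'I_k), i = j.+1 :> nat -> H i j != 0) ->
  mnorm2 N <= 1 -> mnorm2 M <= theta -> 1 <= theta -> 0 <= e <= 2^-1 ->
  (forall v : 'cV_k, 4^-1 * vnorm2 v <= vnorm2 (Z *m pid_mx k *m v)) ->
  mnorm2 (companion M N *m (Z *m pid_mx k) - Z *m H) <= e / 4 ->
  exists DM DN E, [/\ is_so_krylov (M + DM) (N + DN) k
                        (colspace (invmx (1%:M + E) *m P)),
    mnorm2 E <= e, mnorm2 DM <= 4 * e & mnorm2 DN <= 7 * e * theta].
Proof.
move=> em Hh Hn N1 Mt t1 /andP[e0 e2] Zlow Res.
have [|L LZ Lb] := left_inverse_bound _ Zlow; first by rewrite invr_gt0.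
rewrite invrK in Lb; set Rs := _ - Z *m H in Res.
pose D := - (Rs *m L).
have De : mnorm2 D <= e.
  rewrite mnorm2N; apply: le_trans (mnorm2M _ _) _.
  have := ler_pM (mnorm2_ge0 _) (mnorm2_ge0 _) Res Lb.
  by rewrite divfK ?pnatr_eq0.
have CD : (companion M N + D) *m (Z *m pid_mx k) = Z *m H.
  by rewrite mulmxDl mulNmx -mulmxA LZ mulmx1 /Rs opprB addrC subrK.
pose D11 := ulsubmx D; pose D12 := ursubmx D.
pose E := dlsubmx D; pose Y := drsubmx D.
have D11e : mnorm2 D11 <= e.
  by apply: le_trans De; apply: le_trans (mnorm2_lsubmx _) _; exact: mnorm2_usubmx.
have D12e : mnorm2 D12 <= e.
  by apply: le_trans De; apply: le_trans (mnorm2_rsubmx _) _; exact: mnorm2_usubmx.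
have Ee : mnorm2 E <= e.
  by apply: le_trans De; apply: le_trans (mnorm2_lsubmx _) _; exact: mnorm2_dsubmx.
have Ye : mnorm2 Y <= e.
  by apply: le_trans De; apply: le_trans (mnorm2_rsubmx _) _; exact: mnorm2_dsubmx.
have [Xu Xb] := inverse_bound (le_trans Ee e2).
move: CD; rewrite -[D]submxK -/D11 -/D12 -/E -/Y /companion add_block_mx add0r.
rewrite /Z !(mul_col_mx F P) mul_block_col => /eq_col_mx[eqF eqP].
set f1 := F *m _ in eqF eqP; set p1 := P *m _ in eqF eqP.
set X := 1%:M + E in eqP Xu Xb *; clearbody D11 D12 E Y.
pose T := invmx X *m Y *m X.
(* The factors [X^-1], [Y], [X] contribute [2], [e] and [3 / 2]. *)
have Te : mnorm2 T <= 3 * e.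
  have Xn : mnorm2 X <= 3 / 2.
    apply: le_trans (mnorm2D _ _) _.
    have := mnorm2_1 R n; move: (mnorm2 _) (mnorm2 E) Ee => a b be a1.
    by clear - e2 be a1; lra.
  apply: le_trans (mnorm2M _ _) _.
  apply: le_trans (ler_pM (mnorm2_ge0 _) (mnorm2_ge0 _) (mnorm2M _ _) Xn) _.
  have := ler_pM (mnorm2_ge0 _) (mnorm2_ge0 _) Xb Ye.
  move: (_ * mnorm2 Y) => a ae.
  by clear - ae; lra.
(* Read off from [companion_similarity] at the blocks [M + D11], [N + D12], [X], [Y]: the second
   witness is [(N + D12) X - (M + D11) T - N] with [X = 1 + E] expanded. *)
exists (D11 + T), (D12 + (N + D12) *m E - (M + D11) *m T), E; split => //.
- have -> : invmx X *m P = dsubmx (col_mx (F + invmx X *m Y *m P) (invmx X *m P)).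
    by rewrite col_mxKd.
  apply: (companion_span em Hh Hn).
  rewrite /companion !(mul_col_mx (F + _)) mul_block_col mul1mx mul0mx addr0.
  have -> : N + (D12 + (N + D12) *m E - (M + D11) *m T)
            = (N + D12) *m X - (M + D11) *m T.
    by rewrite mulmxDr mulmx1 !addrA.
  rewrite addrA (mulmxDl F) -/f1 -[invmx X *m Y *m P *m _]mulmxA.
  rewrite -[invmx X *m P *m _]mulmxA -/p1; congr col_mx.
    exact: companion_similarity.
  by rewrite -!mulmxA -eqP mulmxDr mulKmx.
- apply: le_trans (mnorm2D _ _) _.
  by move: (mnorm2 D11) (mnorm2 T) D11e Te => a b ae be; clear - ae be; lra.
- apply: le_trans (mnorm2B _ _) _.
  apply: le_trans (lerD (mnorm2D _ _) (mnorm2M _ _)) _.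
  have NE : mnorm2 ((N + D12) *m E) <= 3 / 2 * e.
    apply: le_trans (mnorm2M _ _) _; apply: (ler_pM (mnorm2_ge0 _) (mnorm2_ge0 _) _ Ee).
    apply: le_trans (mnorm2D _ _) _; move: (mnorm2 N) (mnorm2 D12) N1 D12e => a b a1 be.
    by clear - a1 be e2; lra.
  have MT : mnorm2 (M + D11) * mnorm2 T <= (theta + 2^-1) * (3 * e).
    apply: (ler_pM (mnorm2_ge0 _) (mnorm2_ge0 _) _ Te).
    apply: le_trans (mnorm2D _ _) _; move: (mnorm2 M) (mnorm2 D11) Mt D11e => a b a1 be.
    by clear - a1 be e2; lra.
  (* The three bounds add up to [4 e + 3 e theta], hence the constant 7. *)
  have et : e <= e * theta by rewrite ler_peMr.
  apply: le_trans (lerD (lerD D12e NE) MT) _.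
  by clear - et; lra.
Qed.

(** Pair [v] with [w = X^-1 v], where [X = 1 + E]. Their difference is [X^-1 E v], at most
    [2 e |v|], and also [E w], at most [e |w|]; the sum of the two gaps is [3 e]. *)
Lemma dist_invmx n (E : 'M[C]_n) (e : R) d m (Q : 'M[C]_(n, d)) (P : 'M[C]_(n, m)) :
  mnorm2 E <= e -> e <= 2^-1 -> colspace P = colspace Q ->
  \dim (colspace (invmx (1%:M + E) *m P)) = \dim (colspace Q) /\
  dist (colspace Q) (colspace (invmx (1%:M + E) *m P)) <= 3 * e.
Proof.
move=> Ee e2 <-; set X := 1%:M + E.
have e0 : 0 <= e := le_trans (mnorm2_ge0 _) Ee.
have [Xu Xb] := inverse_bound (le_trans Ee e2).
rewrite -/X in Xu Xb.
have VE (v : 'cV_n) : v - X *m v = - (E *m v).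
  by rewrite /X mulmxDl mul1mx opprD addrA subrr sub0r.
split.
  pose f : 'End('cV[C]_n) := linfun (mulmx (invmx X)).
  have -> : colspace (invmx X *m P) = (f @: colspace P)%VS.
    rewrite limg_span; congr <<_>>%VS; rewrite -map_comp; apply: eq_map => j /=.
    by rewrite lfunE /= !colE mulmxA.
  apply: limg_dim_eq; apply/eqP; rewrite -subv0; apply/subvP => v.
  rewrite memv_cap => /andP[_]; rewrite memv_ker lfunE /= => /eqP Xv.
  by rewrite -[v](mulKVmx Xu) Xv mulmx0 mem0v.
have -> : 3 * e = 2 * e + e by clear; ring.
apply: dist_le; rewrite ?mulr_ge0 //.
- move=> _ /colspaceP[a ->]; exists (invmx X *m P *m a).
    by apply/colspaceP; exists a.
  rewrite -mulmxA; move: (P *m a) => v.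
  have -> : v - invmx X *m v = invmx X *m (E *m v).
    apply: (can_inj (mulKmx Xu)); rewrite mulmxBr !mulKVmx //.
    by rewrite -opprB VE opprK.
  apply: le_trans (vnorm2M _ _) _; rewrite -mulrA.
  apply: ler_pM; rewrite ?mnorm2_ge0 ?vnorm2_ge0 //.
  by apply: le_trans (vnorm2M _ _) _; rewrite ler_wpM2r ?vnorm2_ge0.
- move=> _ /colspaceP[a ->]; exists (P *m a); first by apply/colspaceP; exists a.
  rewrite -mulmxA; move: (P *m a) => v.
  rewrite -{2}(mulKVmx Xu v) VE vnorm2N.
  by apply: le_trans (vnorm2M _ _) _; rewrite ler_wpM2r ?vnorm2_ge0.
Qed.

Lemma working_orthonormal_lower m n (X : 'M[C]_(m, n)) (a : R) v :
  mnorm2 (X^t* *m X - 1%:M) <= a ->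
  (1 - a) * vnorm2 v ^+ 2 <= vnorm2 (X *m v) ^+ 2.
Proof.
move=> Xa; rewrite vnorm2_sqr [leRHS]vnorm2_sqr rdot_adj mulmxA.
have -> : X^t* *m X = 1%:M + (X^t* *m X - 1%:M) by rewrite addrC subrK.
rewrite mulmxDl mul1mx; move: (_ - _) Xa => E Ea.
rewrite rdotDr mulrBl mul1r lerD2l lerNl -rdotNr.
apply: le_trans (rdot_le _ _) _; rewrite vnorm2N -vnorm2_sqr expr2 mulrCA.
rewrite ler_wpM2l ?vnorm2_ge0 //.
by apply: le_trans (vnorm2M _ _) _; rewrite ler_wpM2r ?vnorm2_ge0.
Qed.

(** A multiple [S] of [Q T L] moves each column of [Q] to a multiple of the next one. If
    [r (i+1) = S r i], then [r (i+2) = M r (i+1) + (S^2 - M S) r i], whatever [M] is; since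
    [d <= k + 1], the first [k + 1] vectors exhaust the columns of [Q]. *)
Lemma exact_krylov_perturbation n d k (M N : 'M[C]_n) (Q : 'M[C]_(n, d)) :
  \rank Q = d -> (d <= k.+1)%N ->
  exists2 DN, is_so_krylov M (N + DN) k (colspace Q)
            & mnorm2 DN <= 1 + mnorm2 M + mnorm2 N.
Proof.
move=> rQ dk.
have /row_freeP[L' QL] : row_free Q^T by rewrite /row_free mxrank_tr rQ.
pose L := L'^T; have {QL}LQ : L *m Q = 1%:M.
  by rewrite -[LHS]trmxK trmx_mul trmxK QL trmx1.
(* [e i] is zero from [i = d] on, so [T] shifts the sequence at every index. *)
pose e (i : nat) : 'cV[C]_d := \col_l (l == i :> nat)%:R.
pose T : 'M[C]_d := \matrix_(a, b) (a == b.+1 :> nat)%:R.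
have Te i : T *m e i = e i.+1.
  apply/colP => a; rewrite !mxE.
  have [ai|ai] := eqVneq (a : nat) i.+1; last first.
    rewrite big1 // => b _; rewrite !mxE.
    by have [->|] := eqVneq (b : nat) i; rewrite ?mulr0 // (negPf ai) mul0r.
  have id : (i < d)%N by rewrite -ltnS -ai ltnS ltnW.
  rewrite (bigD1 (Ordinal id)) //= !mxE /= ai !eqxx mulr1 big1 ?addr0 // => b.
  by rewrite -(inj_eq val_inj) /= => /negPf bi; rewrite !mxE bi mulr0.
(* Normalises [S] to norm at most 1; the [+ 1] keeps the denominator positive. *)
pose s : R := (mnorm2 (Q *m T *m L) + 1)^-1.
have s1 : 0 < mnorm2 (Q *m T *m L) + 1 by rewrite ltr_wpDl ?mnorm2_ge0.
have s0 : 0 < s by rewrite invr_gt0.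
pose S := s%:C *: (Q *m T *m L).
have S1 : mnorm2 S <= 1.
  rewrite mnorm2ZR gtr0_norm // mulrC ler_pdivrMr // mul1r.
  by rewrite lerDl.
pose r i := s%:C ^+ i *: (Q *m e i).
have Sr i : S *m r i = r i.+1.
  rewrite /r -scalemxAl -scalemxAr scalerA -exprS; congr (_ *: _).
  by rewrite -!mulmxA (mulmxA L) LQ mul1mx Te.
exists (S *m S - M *m S - N).
  exists (r 0%N), (r 1%N).
  rewrite [N + _]addrC subrK.
  have rE i : so_krylov_seq M (S *m S - M *m S) (r 0%N) (r 1%N) i = r i /\
              so_krylov_seq M (S *m S - M *m S) (r 0%N) (r 1%N) i.+1 = r i.+1.
    elim: i => [|i [IH0 IH1]]; first by split.
    split; first exact: IH1.
    rewrite [LHS]/= -/(so_krylov_seq _ _ _ _ i.+1) IH1.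
    rewrite -/(so_krylov_seq _ _ _ _ i) IH0.
    by rewrite mulmxBl -!mulmxA !Sr addrC subrK.
  have -> : so_krylov_space M (S *m S - M *m S) k (r 0%N) (r 1%N)
            = <<mkseq (fun i => s%:C ^+ i *: (Q *m e i)) k.+1>>%VS.
    by congr <<_>>%VS; apply: eq_map => i; exact: (rE i).1.
  rewrite span_scale; last first.
    by move=> i; rewrite expf_neq0 // fmorph_eq0 gt_eqF.
  apply/eqP; rewrite eqEsubv; apply/andP; split; apply/span_subvP.
    move=> _ /mapP[j _ ->]; have -> : col j Q = Q *m e j.
      by rewrite colE; congr (_ *m _); apply/colP => i; rewrite !mxE andbT.
    apply: memv_span; apply: (map_f (fun i => Q *m e i)).
    by rewrite mem_iota /= add0n (leq_trans (ltn_ord j)).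
  by move=> _ /mapP[i _ ->]; apply/colspaceP; exists (e i).
apply: le_trans (mnorm2B _ _) _; rewrite lerD2r.
apply: le_trans (mnorm2B _ _) _; apply: lerD.
  apply: le_trans (mnorm2M _ _) _.
  by rewrite -[leRHS]mulr1 ler_pM ?mnorm2_ge0.
by apply: le_trans (mnorm2M _ _) _; rewrite ler_piMr ?mnorm2_ge0.
Qed.

End Backward.

(** * Application to the computed Arnoldi relation *)

Section Toar.
Variable R : realType.
Local Notation C := R[i].

Lemma small_scale (a b : R) : 0 < a -> 0 <= b ->
  exists2 c, 0 < c & forall t, 0 < t <= c -> t * b <= a.
Proof.
move=> a0 b0; have b1 : 0 < b + 1 by rewrite ltr_wpDl.
exists (a / (b + 1)) => [|t /andP[t0]]; first by rewrite divr_gt0.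
rewrite ler_pdivlMr // mulrDr mulr1; apply: le_trans.
by rewrite lerDl ltW.
Qed.

Lemma subr_addC (V : zmodType) (a b c : V) : a - (b + c) = a - c - b.
Proof. by rewrite opprD addrA addrAC. Qed.

(** Small multiples of [S] and [K] are added to [H0] and [Z V0]: the first makes the subdiagonal
    nonzero, the second gives [V] a right inverse. The lower half of [Z V] keeps the form
    [Q *m V]. *)
Lemma generic_perturbation n p d k m (A : 'M[C]_(n + p)) (F : 'M[C]_(n, m))
    (Q : 'M[C]_(p, d)) (V0 : 'M[C]_(d, m)) (H0 : 'M[C]_(m, k)) (eta : R)
    (Z := fun V => col_mx F (Q *m V)) :
  (d <= m)%N -> upper_hessenberg H0 -> 0 < eta ->
  (forall v : 'cV_k, 2^-1 * vnorm2 v <= vnorm2 (Z V0 *m pid_mx k *m v)) ->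
  exists V H, [/\ upper_hessenberg H,
    forall (i : 'I_m) (j : 'I_k), i = j.+1 :> nat -> H i j != 0,
    exists W, V *m W = 1%:M,
    forall v : 'cV_k, 4^-1 * vnorm2 v <= vnorm2 (Z V *m pid_mx k *m v) &
    mnorm2 (A *m (Z V *m pid_mx k) - Z V *m H)
      <= mnorm2 (A *m (Z V0 *m pid_mx k) - Z V0 *m H0) + eta].
Proof.
move=> dm Hh eta0 low.
(* Marks exactly the vanishing subdiagonal entries of [H0]. *)
pose S : 'M[C]_(m, k) := \matrix_(i, j) ((i == j.+1 :> nat) && (H0 i j == 0))%:R.
have [s s0] := small_scale (divr_gt0 eta0 (ltr0Sn R 1)) (mnorm2_ge0 (Z V0 *m S)).
move=> /(_ s); rewrite s0 lexx => /(_ isT) sS.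
pose H := H0 + s%:C *: S.
pose K : 'M[C]_(n + p, m) := col_mx 0 (Q *m pid_mx d).
(* The residual changes by [t D - s (Z V0) S]. As [D] involves [H], the scale [s] is fixed before
   [t]; each term gets half of [eta]. *)
pose D := A *m (K *m pid_mx k) - K *m H.
have [c1 b10 b1] := small_scale (divr_gt0 eta0 (ltr0Sn R 1)) (mnorm2_ge0 D).
have q0 : 0 < 4^-1 :> R by rewrite invr_gt0.
(* This second limit on [t] lets the lower bound drop only from [2^-1] to [4^-1]. *)
have [c2 b20 b2] := small_scale q0 (mnorm2_ge0 (K *m pid_mx k : 'M_(_, k))).
have c0 : 0 < Num.min c1 c2 by rewrite lt_min b10.
have [t] := full_rank_perturbation V0 dm c0.
rewrite le_min => /and3P[t0 tc1 tc2] VW.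
have {}b1 : t * mnorm2 D <= eta / 2 by apply: b1; rewrite t0.
have {}b2 : t * mnorm2 (K *m pid_mx k : 'M_(_, k)) <= 4^-1 by apply: b2; rewrite t0.
set V := V0 + _ in VW.
have ZV : Z V = Z V0 + t%:C *: K.
  rewrite /Z /K scale_col_mx scaler0 add_col_mx addr0 /V mulmxDr.
  by rewrite -scalemxAr.
exists V, H; split; [| |exact: VW| |].
- move=> i j ij; rewrite !mxE Hh // (gtn_eqF ij) /= mulr0n mulr0 addr0 //.
- move=> i j ij; rewrite !mxE ij eqxx /=.
  have [->|] := eqVneq (H0 i j) 0; last by rewrite mulr0 addr0.
  by rewrite add0r mulr1 fmorph_eq0 gt_eqF.
- move=> v; rewrite ZV mulmxDl mulmxDl -!scalemxAl.
  have := vnorm2D (Z V0 *m pid_mx k *m v + t%:C *: (K *m pid_mx k *m v))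
                  (- (t%:C *: (K *m pid_mx k *m v))).
  rewrite addrK vnorm2N vnorm2ZR (gtr0_norm t0) => h.
  have g : t * vnorm2 (K *m pid_mx k *m v) <= 4^-1 * vnorm2 v.
    apply: le_trans (ler_wpM2r (vnorm2_ge0 v) b2); rewrite -mulrA.
    by rewrite ler_pM2l // vnorm2M.
  move: (le_trans (low v) h) g; move: (t * _) (vnorm2 v) (vnorm2 _) => a b e.
  by clear; lra.
- have -> : A *m (Z V *m pid_mx k) - Z V *m H
      = (A *m (Z V0 *m pid_mx k) - Z V0 *m H0) + (t%:C *: D - s%:C *: (Z V0 *m S)).
    have -> : Z V *m H = Z V0 *m H0 + (s%:C *: (Z V0 *m S) + t%:C *: (K *m H)).
      by rewrite ZV mulmxDl -scalemxAl {1}/H mulmxDr -scalemxAr addrA.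
    have -> : A *m (Z V *m (pid_mx k : 'M_(m, k)))
        = A *m (Z V0 *m pid_mx k) + t%:C *: (A *m (K *m pid_mx k)).
      by rewrite ZV mulmxDl mulmxDr -scalemxAl -scalemxAr.
    rewrite /D scalerBr opprD addrACA; congr (_ + _).
    exact: subr_addC.
  apply: le_trans (mnorm2D _ _) _; rewrite lerD2l.
  apply: le_trans (mnorm2B _ _) _; rewrite !mnorm2ZR (gtr0_norm t0) (gtr0_norm s0).
  by rewrite [leRHS](splitr eta); apply: lerD; [exact: b1 | exact: sS].
Qed.

Lemma colspace_mulmxr n d m (Q : 'M[C]_(n, d)) (V : 'M[C]_(d, m)) W :
  V *m W = 1%:M -> colspace (Q *m V) = colspace Q.
Proof.
move=> VW; apply/vspaceP => v; apply/colspaceP/colspaceP => -[a ->].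
  by exists (V *m a); rewrite mulmxA.
by exists (W *m a); rewrite -mulmxA (mulmxA V) VW mul1mx.
Qed.

Lemma toar_backward_error (c eps theta : R) n k d (M N : 'M[C]_n) (Q : 'M[C]_(n, d)) :
  0 < c -> 0 < eps -> mnorm2 N <= 1 -> mnorm2 M <= theta -> 1 <= theta ->
  toar_computed c eps M N k Q ->
  exists DM DN G, [/\ is_so_krylov (M + DM) (N + DN) k G,
    \dim G = \dim (colspace Q), dist (colspace Q) G <= 112 * c * eps * theta,
    mnorm2 DM <= 112 * c * eps * theta & mnorm2 DN <= 112 * c * eps * theta ^+ 2].
Proof.
move=> c0 eps0 N1 Mt t1 [q [U1 [U2 [x [y [beta [H]]]]]]] /=.
move=> [[_ dk Hh] [[[rQ Qo] _ [_ Uo] _] [_ _ Res]]].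
have t0 : 0 < theta by exact: lt_le_trans t1.
have r0 : 0 < c * eps * theta by rewrite !mulr_gt0.
(* Below the threshold, [16 c eps theta <= 2^-1], as the structured bound requires. Above it, the
   exact perturbation suffices: [1 + |M| + |N| <= 3 theta <= 96 c eps theta^2]. *)
have [big|small] := lerP (32^-1) (c * eps * theta).
  have [DN Gk DNb] := exact_krylov_perturbation M N rQ dk.
  exists 0, DN, (colspace Q); split => //.
  - by rewrite addr0.
  - by rewrite /dist subrr mnorm2_0 -!mulrA mulr_ge0 // !mulrA ltW.
  - by rewrite mnorm2_0 -!mulrA mulr_ge0 // !mulrA ltW.
  - apply: le_trans DNb _.
    have h : 32^-1 * theta <= c * eps * theta ^+ 2.
      by rewrite expr2 mulrA ler_pM2r.
    rewrite -!mulrA (mulrA c); move: (_ * theta ^+ 2) h (mnorm2 M) (mnorm2 N) Mt N1.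
    by move=> a h b f; clear - h t1; lra.
(* [F] and [Q *m V0] are the two halves of the computed Arnoldi vectors; the zero last row of the
   lower coefficient block removes [q] from the second half. *)
pose F := row_mx Q q *m block_mx U1 x 0 beta%:M.
pose V0 := row_mx U2 y.
have pidE : pid_mx k = col_mx 1%:M 0 :> 'M[C]_(k + 1, k) by rewrite pid_mx_col.
have ZE : col_mx F (Q *m V0) *m pid_mx k = kron2 Q *m col_mx U1 U2.
  rewrite pidE mul_col_mx /F /V0 mul_row_block mul_mx_row !mul_row_col.
  by rewrite /kron2 mul_block_col !mulmx1 !mulmx0 !mul0mx !addr0 add0r.
have ZE' : col_mx F (Q *m V0) = kron2 (row_mx Q q) *m
    col_mx (block_mx U1 x 0 beta%:M) (block_mx U2 y 0 0).
  rewrite /kron2 mul_block_col !mul0mx addr0 add0r -/F; congr col_mx.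
  by rewrite mul_row_block !mulmx0 !addr0 mul_mx_row.
have ce : c * eps <= 2^-1.
  have : c * eps <= c * eps * theta by rewrite ler_peMr // mulr_ge0 // ltW.
  by move: (c * eps) (c * eps * theta) small => a b; clear; lra.
(* [Q] and the coefficient matrix each cost a factor [1 - c eps >= 2^-1] in the squared norm, hence
   [2^-1] in the norm. *)
have low (v : 'cV_k) :
    2^-1 * vnorm2 v <= vnorm2 (col_mx F (Q *m V0) *m pid_mx k *m v).
  have ce' : 2^-1 <= 1 - c * eps by move: ce; move: (c * eps) => a; clear; lra.
  rewrite -ler_sqr ?nnegrE ?mulr_ge0 ?invr_ge0 ?vnorm2_ge0 // exprMn.
  rewrite ZE -mulmxA (mul_col_mx U1) /kron2 mul_block_col !mul0mx addr0 add0r.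
  rewrite vnorm2_col_mx.
  have h1 := working_orthonormal_lower (U1 *m v) Qo.
  have h2 := working_orthonormal_lower (U2 *m v) Qo.
  apply: le_trans (lerD h1 h2); rewrite -mulrDr -vnorm2_col_mx -mul_col_mx.
  have h := working_orthonormal_lower v Uo.
  rewrite (expr2 2^-1) -mulrA.
  apply: (ler_pM _ _ ce' (le_trans (ler_wpM2r (sqr_ge0 _) ce') h)).
    by rewrite invr_ge0.
  by rewrite mulr_ge0 ?invr_ge0 ?sqr_ge0.
have [|V [H' [Hh' Hn VW low' Res']]] :=
    generic_perturbation (companion M N) _ Hh r0 low; first by rewrite addn1.
(* A quarter of this is [4 c eps theta]: three parts for the computed residual, as the companion
   matrix has norm at most [3 theta], and one for the generic perturbation. The final constant is
   [112 = 7 * 16]. *)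
have e0 : 0 <= 16 * (c * eps * theta) <= 2^-1.
  by move: r0 small; move: (_ * theta) => a; clear => r0 h; apply/andP; split; lra.
have [|DM [DN [E [Gk Eb DMb DNb]]]] :=
    structured_backward_error (addn1 k) Hh' Hn N1 Mt t1 e0 low'.
  apply: le_trans Res' _; rewrite ZE ZE' mulmxA.
  apply: le_trans (lerD Res (lexx _)) _.
  have Cb : mnorm2 (companion M N) <= 3 * theta.
    apply: le_trans (mnorm2_companion _ _) _.
    by move: (mnorm2 M) (mnorm2 N) Mt N1 => a b; clear - t1; lra.
  have := ler_wpM2l (mulr_ge0 (ltW c0) (ltW eps0)) Cb.
  move: (_ * mnorm2 _) => a; rewrite mulrCA.
  by move: (c * eps * theta) => b; clear; lra.
have [W VW1] := VW.
have [dimG distG] := dist_invmx Eb (proj2 (andP e0)) (colspace_mulmxr Q VW1).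
exists DM, DN, (colspace (invmx (1%:M + E) *m (Q *m V))); split => //.
- apply: le_trans distG _; rewrite -!mulrA (mulrA c).
  by move: (c * eps * theta) r0 => a; clear; lra.
- apply: le_trans DMb _; rewrite -!mulrA (mulrA c).
  by move: (c * eps * theta) r0 => a; clear; lra.
- have -> : 112 * c * eps * theta ^+ 2 = 7 * (16 * (c * eps * theta)) * theta.
    by clear; ring.
  exact: DNb.
Qed.

(** Undoes the scaling, with [s] the inverse of the scaling factor: the perturbations are multiplied
    by [s] and [s ^+ 2], and [is_so_krylov_scale] keeps the subspace. *)
Lemma unscaled_toar_backward_error (c eps theta s : R) n k d (A B : 'M[C]_n)
    (Q : 'M[C]_(n, d)) :
  0 < c -> 0 < eps -> 0 < s -> mnorm2 B = s ^+ 2 -> mnorm2 A <= theta * s ->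
  1 <= theta -> toar_computed c eps (s^-1%:C *: A) ((s^-1 ^+ 2)%:C *: B) k Q ->
  exists DA DB G, [/\ is_so_krylov (A + DA) (B + DB) k G,
    \dim G = \dim (colspace Q), dist (colspace Q) G <= 112 * c * eps * theta,
    mnorm2 DA <= 112 * c * eps * theta * s &
    mnorm2 DB <= 112 * c * eps * theta ^+ 2 * s ^+ 2].
Proof.
move=> c0 eps0 s0 Bs At t1 toar.
have sn : s != 0 by rewrite gt_eqF.
have s20 : 0 < s ^+ 2 by rewrite exprn_gt0.
have N1 : mnorm2 ((s^-1 ^+ 2)%:C *: B) <= 1.
  by rewrite mnorm2ZR (ger0_norm (sqr_ge0 _)) exprVn Bs mulVf ?sqrf_eq0.
have Mt : mnorm2 (s^-1%:C *: A) <= theta.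
  by rewrite mnorm2ZR gtr0_norm ?invr_gt0 // mulrC ler_pdivrMr.
have [DM [DN [G [Gk dG distG DMb DNb]]]] :=
  toar_backward_error c0 eps0 N1 Mt t1 toar.
have sC : s^-1%:C != 0 :> C by rewrite fmorph_eq0 invr_eq0.
exists (s%:C *: DM), ((s ^+ 2)%:C *: DN), G; split; [|exact: dG|exact: distG| |].
- apply: (is_so_krylov_scale sC).
  rewrite !scalerDr !scalerA -rmorphM (mulVf sn) scale1r.
  by rewrite -!rmorphXn -rmorphM -exprMn (mulVf sn) expr1n scale1r.
- by rewrite mnorm2ZR (gtr0_norm s0) mulrC (ler_pM2r s0).
- by rewrite mnorm2ZR (gtr0_norm s20) mulrC (ler_pM2r s20).
Qed.

End Toar.

(* c is the constant in the O(eps)'s satisfied by the computed quantities, rho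
   the tolerance in the relation "about the same size", and K the constant in
   the O(eps)'s of the conclusions; K depends on c and rho only. *)
Theorem theorem4p1 (R : realType) (c rho : R) (hc : 0 < c) (hrho : 1 <= rho) :
  exists2 K : R, 0 < K &
  forall (eps : R) (n k d : nat) (A B : 'M[R[i]]_n) (Q : 'M[R[i]]_(n, d)),
    0 < eps ->
    B != 0 ->
    let sqrtB : R := Num.sqrt (mnorm2 B) in
    let alpha : R := sqrtB^-1 in
    toar_computed c eps (alpha%:C *: A) ((alpha ^+ 2)%:C *: B) k Q ->
    [/\ (* (i) *)
        mnorm2 A <= sqrtB ->
        exists (DA DB : 'M[R[i]]_n) (G : {vspace 'cV[R[i]]_n}),
          [/\ is_so_krylov (A + DA) (B + DB) k G,
              \dim G = \dim (colspace Q),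
              dist (colspace Q) G <= K * eps,
              mnorm2 DA <= K * eps * sqrtB &
              mnorm2 DB / mnorm2 B <= K * eps],
        (* (ii) *)
        rho^-1 * sqrtB <= mnorm2 A <= rho * sqrtB ->
        exists (DA DB : 'M[R[i]]_n) (G : {vspace 'cV[R[i]]_n}),
          [/\ is_so_krylov (A + DA) (B + DB) k G,
              \dim G = \dim (colspace Q),
              dist (colspace Q) G <= K * eps &
              Num.max (mnorm2 DA / mnorm2 A) (mnorm2 DB / mnorm2 B) <= K * eps] &
        (* (iii) *)
        sqrtB < mnorm2 A ->
        exists (DA DB : 'M[R[i]]_n) (G : {vspace 'cV[R[i]]_n}),
          [/\ is_so_krylov (A + DA) (B + DB) k G,
              \dim G = \dim (colspace Q),
              dist (colspace Q) G <= K * eps * sqrtB^-1 * mnorm2 A,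
              mnorm2 DA / mnorm2 A <= K * eps &
              mnorm2 DB <= K * eps * mnorm2 A ^+ 2]].
Proof.
have rho0 : 0 < rho by exact: lt_le_trans hrho.
have K00 : 0 < 112 * c by rewrite mulr_gt0.
have rho1 : rho <= rho ^+ 2 by rewrite expr2 (ler_peMr (ltW rho0)).
have rho2 : 1 <= rho ^+ 2 := le_trans hrho rho1.
(* The factor [rho ^+ 2] is forced by case (ii), where [theta = rho]; the other two cases need only
   [112 * c]. *)
exists (112 * c * rho ^+ 2); first by rewrite mulr_gt0 ?exprn_gt0.
move=> eps n k d A B Q eps0 B0 s alpha toar.
have b0 : 0 < mnorm2 B by rewrite lt_def mnorm2_eq0 B0 mnorm2_ge0.
have s0 : 0 < s by rewrite sqrtr_gt0.
have sE : mnorm2 B = s ^+ 2 by rewrite [RHS]sqr_sqrtr ?(ltW b0).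
have core theta (At : mnorm2 A <= theta * s) (t1 : 1 <= theta) :=
  unscaled_toar_backward_error hc eps0 s0 sE At t1 toar.
rewrite sE; clear toar alpha sE b0; clearbody s.
have s20 : 0 < s ^+ 2 by rewrite exprn_gt0.
pose K := 112 * c * eps; have K0 : 0 < K by rewrite mulr_gt0.
have KE : 112 * c * rho ^+ 2 * eps = K * rho ^+ 2 by rewrite mulrAC.
rewrite KE; rewrite -/K in core; clearbody K; clear KE.
have Krho : K <= K * rho ^+ 2 by rewrite (ler_peMr (ltW K0)).
split.
(* Case (i) takes [theta = 1]. *)
- move=> As; have [||DA [DB [G [Gk dG dGQ DAb DBb]]]] := core 1.
  + by rewrite mul1r.
  + exact: lexx.
  rewrite expr1n !mulr1 in dGQ DAb DBb.
  exists DA, DB, G; split; [exact: Gk | exact: dG | exact: le_trans Krho | |].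
  + by apply: (le_trans DAb); rewrite (ler_pM2r s0).
  + rewrite (ler_pdivrMr _ _ s20); apply: (le_trans DBb).
    by rewrite (ler_pM2r s20).
- move=> /andP[As1 As2].
  (* Here [theta = rho]. One factor [rho] in the bound on [DA] comes from [theta], the other from
     [s <= rho |A|]. *)
  have [DA [DB [G [Gk dG dGQ DAb DBb]]]] := core rho As2 hrho.
  have A0 : 0 < mnorm2 A.
    by apply: lt_le_trans As1; rewrite mulr_gt0 ?invr_gt0.
  exists DA, DB, G; split; [exact: Gk | exact: dG | |].
  + by apply: (le_trans dGQ); rewrite (ler_pM2l K0).
  + rewrite ge_max; apply/andP; split;
      last by rewrite (ler_pdivrMr _ _ s20); exact: DBb.
    rewrite (ler_pdivrMr _ _ A0); apply: (le_trans DAb).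
    rewrite -!mulrA (ler_pM2l K0) (ler_pM2l rho0).
    by rewrite -(ler_pdivrMl _ _ rho0).
- move=> sA; have A0 : 0 < mnorm2 A by exact: lt_trans sA.
  have sn : s != 0 by rewrite (gt_eqF s0).
  (* With [theta = |A| / s], the products [theta * s] and [theta ^+ 2 * s ^+ 2] become [|A|] and
     [|A|^2]. *)
  have [||DA [DB [G [Gk dG dGQ DAb DBb]]]] := core (mnorm2 A / s).
  + by rewrite (divfK sn).
  + by rewrite (ler_pdivlMr _ _ s0) mul1r; exact: ltW.
  rewrite -(mulrA K) (divfK sn) in DAb.
  rewrite -(mulrA K) -exprMn (divfK sn) in DBb.
  exists DA, DB, G; split; [exact: Gk | exact: dG | | |].
  + apply: (le_trans dGQ); rewrite -[leRHS]mulrA [s^-1 * _]mulrC.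
    by rewrite (ler_pM2r (divr_gt0 A0 s0)).
  + by rewrite (ler_pdivrMr _ _ A0); apply: (le_trans DAb); rewrite (ler_pM2r A0).
  + apply: (le_trans DBb).
    by rewrite (ler_pM2r (exprn_gt0 2 A0)).
Qed.
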